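(* Let $X$ be a completely regular space and let $H$ be a non-vanishing closed ideal in $C_B(X)$. Then $H$ is isometrically isomorphic (as a normed algebra) to $C_0(Y)$ for some unique (up to homeomorphism) locally compact space $Y$, namely, for the subspace $$Y=\bigcup_{h\in H}\mathrm{cl}_{\beta X}|h|^{-1}\big((1,\infty)\big)$$ of $\beta X$. In particular, $Y$ is the spectrum of $H$. Furthermore, $Y$ contains $X$ as a dense subspace.
   Context: Completely regular, compact and locally compact spaces are assumed to be Hausdorff. $C_B(X)$ is the normed algebra of continuous bounded $f:X\to\mathbb{C}$ with the supremum norm. $C_0(Y)$ is the set of $f\in C_B(Y)$ such that $|f|^{-1}([1/n,\infty))$ is compact for each positive integer $n$. $\beta X$ is the Stone–Čech compactification of $X$, with $X\subseteq\beta X$. An ideal $H$ of $C_B(X)$ is non-vanishing if for every $x\in X$ there is $h\in H$ with $h(x)\neq0$. The spectrum is the Gelfand spectrum (of a commutative $C^*$-algebra). *)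

(* Defs.v *)
From HB Require Import structures.
From mathcomp Require Import all_boot all_order all_algebra complex.
From mathcomp Require Import all_classical all_reals all_analysis.

Set Implicit Arguments.
Unset Strict Implicit.
Unset Printing Implicit Defensive.

Import Order.TTheory GRing.Theory Num.Theory.
Import numFieldNormedType.Exports.
Local Open Scope classical_set_scope.
Local Open Scope ring_scope.
Local Open Scope complex_scope.

(* The usual topology and normed-space structure of the complex numbers: the
   library only declares them on abstract number fields. *)
HB.instance Definition _ (R : rcfType) := NormedModule.copy R[i] R[i]^o.

Section topology.

Definition topological_embedding (X Y : topologicalType) (e : X -> Y) : Prop :=
  injective e /\
  forall U : set X, open U <-> exists2 V : set Y, open V & e @^-1` V = U.

Definition homeomorphic (X Y : topologicalType) : Prop :=
  exists (f : X -> Y) (g : Y -> X),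
    [/\ cancel f g, cancel g f, continuous f & continuous g].

Definition compact_hausdorff (X : topologicalType) : Prop :=
  compact [set: X] /\ hausdorff_space X.

Definition locally_compact_hausdorff (X : topologicalType) : Prop :=
  locally_compact [set: X] /\ hausdorff_space X.

(* [completely_regular_space] does not include the Hausdorff axiom. *)
Definition completely_regular_hausdorff (X : topologicalType) : Prop :=
  completely_regular_space X /\ hausdorff_space X.

(* [e : X -> bX] is the Stone-Cech compactification of [X]; the inclusion of
   [X] in [bX] is represented by the embedding [e]. *)
Definition stone_cech (X bX : topologicalType) (e : X -> bX) : Prop :=
  [/\ compact_hausdorff bX, topological_embedding e, dense (range e) &
    forall (K : topologicalType) (f : X -> K),
      compact_hausdorff K -> continuous f ->
      exists2 F : bX -> K, continuous F & forall x, F (e x) = f x].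

End topology.

(* Normed algebras of complex functions are sets of functions, with the
   pointwise operations and the supremum norm. *)
Section function_algebras.
Variable R : realType.

Definition CB (X : topologicalType) : set (X -> R[i]) :=
  [set f | continuous f /\ [bounded f x | x in [set: X]]].

(* The norm of [R[i]] takes its values in [R[i]], whence the real part.  On the
   empty space the supremum norm is [0], as [sup set0 = 0]. *)
Definition sup_norm (X : Type) (f : X -> R[i]) : R :=
  sup (range (fun x => complex.Re `|f x|)).

Definition C0 (Y : topologicalType) : set (Y -> R[i]) :=
  [set f | CB f /\
    forall n : nat, (0 < n)%N -> compact [set y | n%:R^-1 <= `|f y|]].

(* Stability under multiplication by the constant functions makes an ideal of
   the unital algebra [CB X] a linear subspace. *)
Definition CB_ideal (X : topologicalType) (H : set (X -> R[i])) : Prop :=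
  [/\ H `<=` @CB X, H (fun=> 0),
    forall f g, H f -> H g -> H (f + g) &
    forall f g, CB f -> H g -> H (f * g)].

Definition CB_closed (X : topologicalType) (H : set (X -> R[i])) : Prop :=
  forall f, CB f ->
    (forall eps : R, 0 < eps -> exists2 h, H h & sup_norm (f - h) < eps) ->
  H f.

Definition non_vanishing (X : Type) (H : set (X -> R[i])) : Prop :=
  forall x, exists2 h, H h & h x != 0.

Definition isometrically_isomorphic (X Y : Type)
    (A : set (X -> R[i])) (B : set (Y -> R[i])) : Prop :=
  exists T : (X -> R[i]) -> (Y -> R[i]),
    [/\ set_bij A B T,
      forall f g, A f -> A g -> T (f + g) = T f + T g,
      forall (a : R[i]) f, A f -> T (a *: f) = a *: T f,
      forall f g, A f -> A g -> T (f * g) = T f * T g &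
      forall f, A f -> sup_norm (T f) = sup_norm f].

(* Nonzero multiplicative linear functionals on [A]; continuity is automatic
   when [A] is a Banach algebra. *)
Definition character (X : Type) (A : set (X -> R[i]))
    (phi : set_type A -> R[i]) : Prop :=
  [/\ forall f g h : set_type A,
        val h = val f + val g -> phi h = phi f + phi g,
      forall (a : R[i]) (f h : set_type A),
        val h = a *: val f -> phi h = a * phi f,
      forall f g h : set_type A,
        val h = val f * val g -> phi h = phi f * phi g &
      exists f, phi f != 0].

(* The Gelfand spectrum carries the weak-* topology, that is, the topology of
   pointwise convergence on [A]. *)
Definition spectrum (X : Type) (A : set (X -> R[i])) : topologicalType :=
  set_type [set phi : {ptws set_type A -> R[i]} | character phi].

Definition ideal_support (X bX : topologicalType) (e : X -> bX)
    (H : set (X -> R[i])) : set bX :=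
  \bigcup_(h in H) closure (e @` [set x | 1 < `|h x|]).

End function_algebras.

(* Existence of the Stone-Cech compactification: the closure of the image of [X]
   in the cube of its [0, 1]-valued continuous functions. *)
Section stone_cech_existence.
Variable R : realType.

Definition unit_functions (X : topologicalType) : set (X -> R) :=
  [set f : X -> R | continuous f /\ range f `<=` `[0, 1]].

Definition cube (X : topologicalType) : topologicalType :=
  {ptws set_type (@unit_functions X) -> R}.

Definition to_cube (X : topologicalType) : X -> cube X :=
  fun x f => val f x.

Lemma to_cubeE (X : topologicalType) :
  @to_cube X = join_product (fun f : set_type (@unit_functions X) => val f).
Proof. by []. Qed.

Lemma continuous_to_cube (T K : topologicalType) (F : T -> cube K) :
  (forall g, continuous (fun t => F t g)) -> continuous F.
Proof.
move=> cF x; apply/cvg_sup => g A [_ [[V oV <-] Vx] VA].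
by apply: filterS VA _; apply: (cF g x); exact: open_nbhs_nbhs.
Qed.

Lemma to_cube_continuous (X : topologicalType) : continuous (@to_cube X).
Proof.
by apply: continuous_to_cube => f; have [] := set_mem (valP f).
Qed.

Lemma to_cube_embedding (X : topologicalType) :
  completely_regular_hausdorff X -> topological_embedding (@to_cube X).
Proof.
move=> [Xcr XT2].
have fc (f : set_type (@unit_functions X)) : continuous (val f).
  by have [] := set_mem (valP f).
have sep : separate_points_from_closed
    (fun f : set_type (@unit_functions X) => val f).
  move=> U x cU nUx.
  have /(@uniform_separatorP _ R) [f [cf f01 fx fU]] := Xcr x U cU nUx.
  have fA : f \in @unit_functions X by apply/mem_set.
  exists (exist _ f fA) => /=.
  have -> : f x = 0 by apply: fx; exists x.
  move=> /(closureS fU); rewrite -(closure_id _).1; last exact/accessible_closed_set1/hausdorff_accessible/Rhausdorff.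
  by move=> /esym/eqP; rewrite oner_eq0.
have inj := join_product_inj sep (hausdorff_accessible XT2).
split=> [x y xy|U]; first by apply: inj xy; rewrite inE.
by rewrite (join_product_initial sep fc inj).
Qed.

Lemma compact_set_type (T : topologicalType) (A : set T) :
  compact A -> compact [set: set_type A].
Proof.
move=> cA F PF _.
have [|p [Ap clp]] := cA ((val : set_type A -> T) @ F) (fmap_proper_filter _ PF).
  by apply: (@filterS _ F _ setT) filterT => -[x xA] _; exact: set_mem xA.
exists (exist _ p (mem_set Ap)); split=> // S U FS [V [[W oW <-] Wp] WU].
have [||_ [[s Ss <-] Ws]] := clp (val @` S) W.
- by apply: (@filterS _ F _ S) FS => s Ss; exists s.
- exact: open_nbhs_nbhs.
by exists s; split=> //; exact: WU.
Qed.

Lemma hausdorff_set_type (T : topologicalType) (A : set T) :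
  hausdorff_space T -> hausdorff_space (set_type A).
Proof.
move=> T2 x y xy; apply: val_inj; apply: T2 => U V Ux Vy.
have [|| z [Uz Vz]] := xy (val @^-1` U) (val @^-1` V).
- exact: initial_continuous Ux.
- exact: initial_continuous Vy.
by exists (val z).
Qed.

Lemma cube_hausdorff (X : topologicalType) : hausdorff_space (cube X).
Proof. by apply: hausdorff_product => _; exact: Rhausdorff. Qed.

Definition beta_set (X : topologicalType) : set (cube X) :=
  closure (range (@to_cube X)).

Lemma beta_set_compact (X : topologicalType) : compact (@beta_set X).
Proof.
have cK : compact [set p : cube X | forall f, `[0, 1]%classic (p f)].
  by apply: (@tychonoff _ (fun=> R) (fun=> `[0, 1]%classic)) => _; exact: segment_compact.
apply: (subclosed_compact _ cK); first exact: closed_closure.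
have clK := compact_closed (@cube_hausdorff X) cK.
rewrite /beta_set; move/closure_id: clK => ->; apply: closureS => _ [x _ <-] f /=.
by have [_] := set_mem (valP f); apply; exists x.
Qed.

Definition to_beta (X : topologicalType) (x : X) : set_type (@beta_set X) :=
  exist _ (to_cube x) (mem_set (subset_closure (imageP _ I))).

Lemma compact_hausdorff_completely_regular (K : topologicalType) :
  compact_hausdorff K -> completely_regular_hausdorff K.
Proof.
move=> [Kc KT2]; split=> //; apply: (@normal_completely_regular R).
  exact: compact_normal.
exact: hausdorff_accessible.
Qed.

Lemma stone_cech_to_beta (X : topologicalType) :
  completely_regular_hausdorff X -> stone_cech (@to_beta X).
Proof.
move=> hX; have [einj eopen] := to_cube_embedding hX; split.
- split; first exact/compact_set_type/beta_set_compact.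
  exact/hausdorff_set_type/cube_hausdorff.
- split=> [x y /(congr1 val)|U]; first exact: einj.
  rewrite eopen; split=> [[V oV <-]|[_ [V oV <-] <-]]; last by exists V.
  by exists (val @^-1` V) => //; exists V.
- move=> W [p Wp] [V oV VE]; rewrite -VE in Wp *; move: Wp => Vp.
  have [|_ [[x _ <-] Vx]] := set_mem (valP p) V; first exact: open_nbhs_nbhs.
  by exists (to_beta x); split => //; exists x.
move=> K f hK cf; have [Kc KT2] := hK.
have hK' := compact_hausdorff_completely_regular hK.
have [kinj kopen] := to_cube_embedding hK'.
have gf (g : set_type (@unit_functions K)) : val g \o f \in @unit_functions X.
  have [cg g01] := set_mem (valP g); apply/mem_set; split=> [x|_ [x _ <-]].
    exact: (continuous_comp (cf x) (cg _)).
  by apply: g01; exists (f x).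
pose gF g : set_type (@unit_functions X) :=
  exist (fun h => h \in @unit_functions X) _ (gf g).
pose F (p : cube X) : cube K := fun g => p (gF g).
have cF : continuous F.
  apply: continuous_to_cube => g.
  exact: (@proj_continuous _ (fun=> R) (gF g)).
have Fe x : F (to_cube x) = to_cube (f x) by [].
have clK : closed (range (@to_cube K)).
  apply: compact_closed; first exact: cube_hausdorff.
  by apply: continuous_compact Kc; apply: continuous_subspaceT; exact: to_cube_continuous.
have Frange (p : set_type (@beta_set X)) : range (@to_cube K) (F (val p)).
  have /closure_id FE : closed (F @^-1` range (@to_cube K)).
    by apply: closed_comp => // q _; exact: cF.
  rewrite -[range _ _]/((F @^-1` range (@to_cube K)) (val p)) FE.
  apply: closureS (set_mem (valP p)).
  by move=> _ [x _ <-]; exists (f x).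
pose G p := projT1 (cid2 (Frange p)).
have GE p : to_cube (G p) = F (val p) by rewrite /G; case: cid2.
exists G => [|x]; last by apply: kinj; rewrite GE.
apply/continuousP => U /kopen [V oV <-].
exists (F @^-1` V); first by apply: open_comp => // *; exact: cF.
by apply/seteqP; split=> p /=; rewrite GE.
Qed.

End stone_cech_existence.

(* Main.v *)
(* Let [f^b] denote the extension of a bounded function [f] to [bX].  Since [H] is
   stable under scaling, [Y] is the open set of the points where some [h^b] with
   [h] in [H] does not vanish, and restricting [h^b] to [Y] maps [H] isometrically
   into [C0 Y].  The map is onto: if [g] in [C0 Y], extended by [0] to [bX],
   satisfies [|g| >= eps] exactly on the compact set [K], some finite sum [r] of
   functions [h^b * conj h^b] is at least [1] on [K], and
   [g - g / (1 + c r) = c r g / (1 + c r)] comes from [H] and is within [eps] of [g]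
   for large [c].  The same damping trick shows that every character of [C0 Z] is a
   point evaluation: otherwise [r] could be chosen in the kernel of the character
   [phi], and from [phi u = 1] one would get [v = u / (1 + c r)] with [phi v = 1] and
   [|v| <= 1/2], which is absurd.  Hence [Z] is the spectrum of [C0 Z], which gives
   both the spectrum of [H] and the uniqueness of [Y]. *)
Require Import Defs.
From HB Require Import structures.
From mathcomp Require Import all_boot all_order all_algebra complex.
From mathcomp Require Import all_classical all_reals all_analysis.
From mathcomp Require Import ring lra.

Set Implicit Arguments.
Unset Strict Implicit.
Unset Printing Implicit Defensive.

Import Order.TTheory GRing.Theory Num.Theory.
Import numFieldNormedType.Exports ComplexField.Normc.
Local Open Scope classical_set_scope.
Local Open Scope ring_scope.
Local Open Scope complex_scope.

(** * The modulus as a real number, and continuity of complex functions *)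

Section complex_functions.
Variable R : realType.
Implicit Types (z w : R[i]) (r : R).

Lemma normr_normc z : `|z| = (normc z)%:C.
Proof. by []. Qed.

Lemma normc_ge0 z : 0 <= normc z.
Proof. by rewrite -ler0c -normr_normc. Qed.

Lemma normc_eq0 z : (normc z == 0) = (z == 0).
Proof. by apply/eqP/eqP => [/eq0_normc|->]; last exact: normc0. Qed.

Lemma normc_gt0 z : (0 < normc z) = (z != 0).
Proof. by rewrite lt_neqAle normc_ge0 andbT eq_sym normc_eq0. Qed.

Lemma normc_distrC z w : normc (z - w) = normc (w - z).
Proof. by rewrite -opprB normcN. Qed.

Lemma normc_real r : normc r%:C = `|r|.
Proof. by rewrite /= expr0n addr0 sqrtr_sqr. Qed.

Lemma normcJ z : normc z^* = normc z.
Proof. by case: z => a b /=; rewrite sqrrN. Qed.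

Lemma mulcJ_normc z : z * z^* = (normc z ^+ 2)%:C.
Proof. by rewrite -sqr_normc normr_normc rmorphXn. Qed.

Lemma normc_ge_Re z : `|complex.Re z| <= normc z.
Proof. by rewrite -lecR; exact: normc_ge_Re. Qed.

Lemma normc_ge_Im z : `|complex.Im z| <= normc z.
Proof.
case: z => a b /=; rewrite -[X in X <= _]sqrtr_sqr ler_wsqrtr// lerDr.
exact: sqr_ge0.
Qed.

(** The radii in the library's criterion are positive elements of [R[i]]. Such elements are real, so
    real radii suffice. *)
Lemma cvg_normcP (T : Type) (F : set_system T) (FF : Filter F)
    (f : T -> R[i]) z :
  f @ F --> z <->
  forall eps : R, 0 < eps -> \forall t \near F, normc (z - f t) < eps.
Proof.
split=> [/cvgrPdist_lt fz eps eps0|fz].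
  have := fz eps%:C; rewrite ltcR => /(_ eps0); apply: filterS => t.
  by rewrite normr_normc ltcR.
apply: (proj2 (cvgrPdist_lt _ _)) => eps eps0.
have epsE : eps = (complex.Re eps)%:C by rewrite RRe_real// gtr0_real.
have := fz (complex.Re eps); rewrite -ltcR -epsE => /(_ eps0).
by apply: filterS => t; rewrite -ltcR -epsE.
Qed.

Lemma near_normc z r : 0 < r -> \forall w \near z, normc (z - w) < r.
Proof. by move: r; apply/(cvg_normcP (nbhs_filter z)); exact: cvg_id. Qed.

Lemma continuous_normc : continuous (@normc R).
Proof.
move=> z; apply/(@cvgrPdist_lt _ _ _ _ (nbhs_filter z)) => eps eps0.
have := near_normc z eps0.
apply: filterS => w; apply: le_lt_trans; rewrite ler_norml.
have := le_normcD (z - w) w; have := le_normcD (w - z) z.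
by rewrite !subrK (normc_distrC w); lra.
Qed.

Lemma continuous_Re : continuous (@complex.Re R).
Proof.
move=> z; apply/(@cvgrPdist_lt _ _ _ _ (nbhs_filter z)) => eps eps0.
have := near_normc z eps0.
apply: filterS => w; apply: le_lt_trans.
by rewrite -raddfB; exact: normc_ge_Re.
Qed.

Lemma continuous_Im : continuous (@complex.Im R).
Proof.
move=> z; apply/(@cvgrPdist_lt _ _ _ _ (nbhs_filter z)) => eps eps0.
have := near_normc z eps0.
apply: filterS => w; apply: le_lt_trans.
by rewrite -raddfB; exact: normc_ge_Im.
Qed.

Lemma continuous_conjc : continuous (@conjc R).
Proof.
move=> z; apply/(cvg_normcP (nbhs_filter z)) => eps eps0.
have := near_normc z eps0.
by apply: filterS => w; rewrite -rmorphB normcJ.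
Qed.

Lemma continuous_real_complex : continuous (fun r => r%:C).
Proof.
move=> r; apply/(cvg_normcP (nbhs_filter r)) => eps eps0.
have /cvgrPdist_lt/(_ eps eps0) : r' @[r' --> r] --> r by [].
by apply: filterS => w; rewrite -rmorphB normc_real.
Qed.

Variable T : topologicalType.
Implicit Types f g : T -> R[i].

Lemma continuous_addc f g : continuous f -> continuous g -> continuous (f + g).
Proof. by move=> cf cg t; apply: cvgD; [exact: cf|exact: cg]. Qed.

Lemma continuous_subc f g :
  continuous f -> continuous g -> continuous (fun t => f t - g t).
Proof. by move=> cf cg t; apply: cvgB; [exact: cf|exact: cg]. Qed.

Lemma continuous_mulc f g : continuous f -> continuous g -> continuous (f * g).
Proof. by move=> cf cg t; apply: cvgM; [exact: cf|exact: cg]. Qed.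

Lemma continuous_invc f :
  continuous f -> (forall t, f t != 0) -> continuous (fun t => (f t)^-1).
Proof. by move=> cf f0 t; apply: cvgV; [exact: f0|exact: cf]. Qed.

Lemma continuous_comp_normc f : continuous f -> continuous (fun t => normc (f t)).
Proof. by move=> cf t; apply: continuous_comp; [exact: cf|exact: continuous_normc]. Qed.

Lemma continuous_comp_conjc f : continuous f -> continuous (fun t => (f t)^*).
Proof. by move=> cf t; apply: continuous_comp; [exact: cf|exact: continuous_conjc]. Qed.

Lemma open_normc_gt f r : continuous f -> open [set t | r < normc (f t)].
Proof.
move=> cf; rewrite -[X in open X]/((fun t => normc (f t)) @^-1` [set s | r < s]).
apply: open_comp; last exact: open_gt.
by move=> t _; exact: (continuous_comp_normc cf).
Qed.

Lemma closed_normc_ge f r : continuous f -> closed [set t | r <= normc (f t)].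
Proof.
move=> cf; rewrite -[X in closed X]/((fun t => normc (f t)) @^-1` [set s | r <= s]).
apply: preimage_closed; last exact: closed_ge.
by move=> t _; exact: (continuous_comp_normc cf).
Qed.

End complex_functions.

(** * Bounded functions and ideals *)

Section bounded_continuous.
Variable R : realType.

Lemma bounded_normcP (T : Type) (f : T -> R[i]) :
  [bounded f x | x in [set: T]] <->
  exists2 M : R, 0 <= M & forall t, normc (f t) <= M.
Proof.
split=> [[M [Mreal fM]]|[M M0 fM]].
  (* Boundedness speaks of the numbers strictly above [M], and [M] may be negative. The number
     [|M| + 1] is above it and non-negative. *)
  exists (complex.Re (`|M| + 1)) => [|t].
    have : (0 : R[i]) <= `|M| + 1 by rewrite addr_ge0.
    by rewrite lecE => /andP[].
  have lt : M < `|M| + 1.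
    by rewrite (le_lt_trans (real_ler_norm Mreal))// ltrDl.
  have := fM _ lt t I; rewrite /= normr_normc.
  by rewrite lecE => /andP[].
exists M%:C; split; first by rewrite complex_real.
move=> N MN t _ /=; apply: le_trans (ltW MN).
by rewrite normr_normc lecR.
Qed.

Lemma CBP (T : topologicalType) (f : T -> R[i]) :
  CB f <-> continuous f /\ exists2 M : R, 0 <= M & forall t, normc (f t) <= M.
Proof. by rewrite -bounded_normcP. Qed.

Lemma normc_le_sup_norm (T : topologicalType) (f : T -> R[i]) t :
  CB f -> normc (f t) <= sup_norm f.
Proof.
move=> /CBP[_ [M _ fM]]; apply: ub_le_sup; last by exists t.
by exists M => _ [s _ <-]; exact: fM.
Qed.

Lemma sup_norm_le (T : Type) (f : T -> R[i]) (M : R) :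
  0 <= M -> (forall t, normc (f t) <= M) -> sup_norm f <= M.
Proof.
move=> M0 fM; rewrite /sup_norm; set A := (X in sup X).
have [->|A0] := eqVneq A set0; first by rewrite sup0.
by apply: ge_sup => [|_ [s _ <-]]; [exact/set0P|exact: fM].
Qed.

Section algebra.
Variable T : topologicalType.
Implicit Types f g : T -> R[i].

Lemma CB_continuous f : CB f -> continuous f.
Proof. by case. Qed.

Lemma CB_cst z : CB (fun _ : T => z : R[i]).
Proof.
by apply/CBP; split; [exact: cst_continuous|exists (normc z); rewrite ?normc_ge0].
Qed.

Lemma CB_add f g : CB f -> CB g -> CB (f + g).
Proof.
move=> /CBP[cf [M M0 fM]] /CBP[cg [N N0 gN]].
apply/CBP; split; first exact: continuous_addc.
exists (M + N) => [|t]; first exact: addr_ge0.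
by rewrite (le_trans (le_normcD _ _))// lerD.
Qed.

Lemma CB_mul f g : CB f -> CB g -> CB (f * g).
Proof.
move=> /CBP[cf [M M0 fM]] /CBP[cg [N N0 gN]].
apply/CBP; split; first exact: continuous_mulc.
exists (M * N) => [|t]; first exact: mulr_ge0.
by rewrite normcM ler_pM ?normc_ge0.
Qed.

Lemma CB_conj f : CB f -> CB (fun t => (f t)^*).
Proof.
move=> /CBP[cf [M M0 fM]]; apply/CBP; split; first exact: continuous_comp_conjc.
by exists M => // t; rewrite normcJ.
Qed.

Lemma CB_inv f (d : R) :
  continuous f -> 0 < d -> (forall t, d <= normc (f t)) ->
  CB (fun t => (f t)^-1).
Proof.
move=> cf d0 fd; apply/CBP; split.
  by apply: continuous_invc => // t; rewrite -normc_gt0 (lt_le_trans d0).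
exists d^-1 => [|t]; first by rewrite invr_ge0 ltW.
by rewrite normcV lef_pV2// posrE// (lt_le_trans d0).
Qed.

(** Frees [C0] from the radii [1/n]: for [1/n <= eps], the superlevel set at [eps] is closed in the
    compact one at [1/n]. *)
Lemma C0P f :
  C0 f <-> CB f /\ forall eps : R, 0 < eps -> compact [set t | eps <= normc (f t)].
Proof.
split=> -[CBf Kf]; split=> //; [move=> eps eps0|move=> n n0].
  have [n [n0 neps]] : exists n, (0 < n)%N /\ n%:R^-1 <= eps.
    exists (Num.bound eps^-1).+1; split => //.
    rewrite invf_ple ?posrE ?ltr0n// (le_trans (ltW (archi_boundP _)))//.
      by rewrite invr_ge0 ltW.
    by rewrite ler_nat.
  apply: subclosed_compact (Kf n n0) _; first exact/closed_normc_ge/CB_continuous.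
  move=> t /= epsf; rewrite normr_normc -(rmorph_nat (real_complex R)) -fmorphV lecR.
  exact: le_trans epsf.
have := Kf n%:R^-1; rewrite invr_gt0 ltr0n => /(_ n0); congr compact.
apply/seteqP; split=> t /=.
  by rewrite normr_normc -(rmorph_nat (real_complex R)) -fmorphV lecR.
by rewrite normr_normc -(rmorph_nat (real_complex R)) -fmorphV lecR.
Qed.

Lemma C0_ideal : CB_ideal (@C0 R T).
Proof.
split; first by move=> f [].
- apply/C0P; split=> [|eps eps0]; first exact: CB_cst.
  rewrite (_ : mkset _ = set0); first exact: compact0.
  by apply/seteqP; split=> // t; rewrite /mkset normc0 leNgt eps0.
- move=> f g /C0P[CBf Kf] /C0P[CBg Kg]; apply/C0P; split=> [|eps eps0].
    exact: CB_add.
  have eps20 : 0 < eps / 2 by rewrite divr_gt0.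
  apply: subclosed_compact (compactU (Kf _ eps20) (Kg _ eps20)) _.
    exact/closed_normc_ge/CB_continuous/CB_add.
  move=> t /= /le_trans/(_ (le_normcD (f t) (g t))) fg.
  have [|ft] := leP (eps / 2) (normc (f t)); first by left.
  by right; rewrite /mkset; lra.
- move=> f g CBf /C0P[CBg Kg]; apply/C0P; split=> [|eps eps0].
    exact: CB_mul.
  have /CBP[_ [M M0 fM]] := CBf.
  (* The bound [M] may be [0]; the shift makes it a legitimate divisor. *)
  have M1 : 0 < M + 1 by rewrite ltr_wpDl.
  have epsM0 : 0 < eps / (M + 1) by rewrite divr_gt0.
  apply: subclosed_compact (Kg _ epsM0) _.
    exact/closed_normc_ge/CB_continuous/CB_mul.
  move=> t /=; rewrite normcM ler_pdivrMr// => /le_trans; apply.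
  by rewrite mulrC ler_wpM2l ?normc_ge0// (le_trans (fM t))// lerDl.
Qed.

Section ideal.
Variable A : set (T -> R[i]).
Hypothesis A_ideal : CB_ideal A.

Lemma ideal_CB f : A f -> CB f.
Proof. by move=> Af; have [sub _ _ _] := A_ideal; exact: sub. Qed.

Lemma ideal_add f g : A f -> A g -> A (f + g).
Proof. by have [_ _ AD _] := A_ideal; exact: AD. Qed.

Lemma ideal_mul f g : CB f -> A g -> A (f * g).
Proof. by have [_ _ _ AM] := A_ideal; exact: AM. Qed.

Lemma ideal_scale (z : R[i]) f : A f -> A (z *: f).
Proof. by move=> Af; apply: (ideal_mul (CB_cst z)). Qed.

End ideal.

Lemma CB_damping (r : T -> R) (c : R) :
  continuous (fun t => (r t)%:C) -> (forall t, 0 <= r t) -> 0 <= c ->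
  CB (fun t => ((1 + c * r t)%:C)^-1).
Proof.
move=> cr r0 c0.
have d1 t : 1 <= normc (1 + c * r t)%:C.
  by rewrite normc_real ler_normr lerDl mulr_ge0.
suff cd : continuous (fun t => (1 + c * r t)%:C : R[i]) by exact: CB_inv ltr01 d1.
have -> : (fun t => (1 + c * r t)%:C) = (fun=> 1) + (fun=> c%:C) * (fun t => (r t)%:C).
  by apply/funext => t; rewrite rmorphD rmorphM rmorph1.
apply: continuous_addc; first exact: cst_continuous.
by apply: continuous_mulc cr; exact: cst_continuous.
Qed.

(** Used with [z = f t] and [s = r t]: the first summand is made small by a large [c], while the
    second carries the factor [r] and so lies in every ideal containing [r]. *)
Lemma damping_split (z : R[i]) (c s : R) : 0 <= c -> 0 <= s ->
  z = ((1 + c * s)%:C)^-1 * z + c%:C * (((1 + c * s)%:C)^-1 * z * s%:C).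
Proof.
move=> c0 s0; have : (1 + c * s)%:C != 0.
  by rewrite -normc_gt0 normc_real normr_gt0 gt_eqF// ltr_wpDr// mulr_ge0.
by rewrite rmorphD rmorphM rmorph1 => d0; field.
Qed.

(* Where [|f|] is not small, [r >= 1] and a large [c] makes the quotient small. *)
Lemma damping_small f (r : T -> R) (eps M : R) :
  0 < eps -> 0 <= M -> (forall t, normc (f t) <= M) -> (forall t, 0 <= r t) ->
  (forall t, eps <= normc (f t) -> 1 <= r t) ->
  forall t, normc (f t * ((1 + M / eps * r t)%:C)^-1) <= eps.
Proof.
move=> eps0 M0 fM r0 r1 t.
have Meps : 0 <= M / eps by rewrite divr_ge0// ltW.
have d1 : 1 <= 1 + M / eps * r t by rewrite lerDl mulr_ge0.
have d0 : 0 < 1 + M / eps * r t by exact: lt_le_trans d1.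
rewrite normcM normcV normc_real gtr0_norm// ler_pdivrMr//.
have [feps|feps] := leP eps (normc (f t)).
  rewrite mulrDr mulrA (mulrC eps (M / eps)) divfK ?gt_eqF// (le_trans (fM t))//.
  rewrite (le_trans (_ : M <= M * r t))//; first by rewrite ler_peMr// r1.
  by rewrite mulr1 lerDr ltW.
by rewrite (le_trans (ltW feps))// ler_peMr// ltW.
Qed.

(** The squares [|f|^2], products of [f] with its bounded conjugate, stay in the ideal. Being
    non-negative they add up without cancellation, and compactness of [K] turns the pointwise
    hypothesis into a single [r]. *)
Lemma dominating_square_sum (A : set (T -> R[i])) (K : set T) :
  CB_ideal A -> compact K ->
  (forall t, K t -> exists2 f, A f & f t != 0) ->
  exists r : T -> R, [/\ A (fun t => (r t)%:C), forall t, 0 <= r t &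
    forall t, K t -> 1 <= r t].
Proof.
move=> A_ideal /compact_near_coveringP Kc Ane.
have [Acont A0 AD AM] := A_ideal.
pose good (r : T -> R) := A (fun t => (r t)%:C) /\ forall t, 0 <= r t.
have good0 : good (fun=> 0) by split=> //; exact: A0.
have goodD r s : good r -> good s -> good (fun t => r t + s t).
  move=> [Ar r0] [As s0]; split=> [|t]; last exact: addr_ge0.
  by have := AD _ _ Ar As; congr A; apply/funext => t; rewrite rmorphD.
(* The good functions form a directed family; near-covering compactness along
   the filter of its upper sets replaces the choice of a finite subcover. *)
pose F : set_system (T -> R) :=
  [set P | exists2 r, good r & forall s, good s -> (forall t, r t <= s t) -> P s].
have FF : Filter F.
  split=> [|P Q [r rG rP] [s sG sQ]|P Q PQ [r rG rP]].
  - by exists (fun=> 0).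
  - exists (fun t => r t + s t) => [|u uG rsu]; first exact: goodD.
    have [[_ r0] [_ s0]] := (rG, sG).
    by split; [apply: rP|apply: sQ] => // t; rewrite (le_trans _ (rsu t))// ?lerDl ?lerDr.
  - by exists r => // s sG rs; apply: PQ; exact: rP.
(* The upper set obtained contains its own generator [r], which is the function sought. *)
have [t Kt|r [Ar r0] rP] := Kc _ F (fun r t => good r -> 1 <= r t) FF; last first.
  by exists r; split=> // t Kt; apply: rP.
have [f Af ft0] := Ane t Kt.
(* The factor [2] gives [b t = 2], so [b > 1] on a neighbourhood of [t], and so is every function
   above [b]. *)
pose b s := 2 / normc (f t) ^+ 2 * normc (f s) ^+ 2.
have b0 s : 0 <= b s by rewrite mulr_ge0 ?sqr_ge0// divr_ge0 ?sqr_ge0.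
have Ab : A (fun s => (b s)%:C).
  have cf : CB (fun s => (f s)^*) by exact/CB_conj/Acont.
  have := AM _ _ (CB_mul (CB_cst (2 / normc (f t) ^+ 2)%:C) cf) Af.
  congr A; apply/funext => s; rewrite !fctE.
  by rewrite -mulrA [_^* * _]mulrC mulcJ_normc -rmorphM.
exists ([set s | 1 < normc (b s)%:C], [set r : T -> R | forall s, b s <= r s]).
  split; last by exists b => // s _ bs.
  apply: open_nbhs_nbhs; split; first exact/open_normc_gt/CB_continuous/Acont.
  suff : 1 < normc (b t)%:C by [].
  by rewrite normc_real ger0_norm// /b divfK ?ltr1n// expf_neq0// normc_eq0.
move=> [s r] [bs br] _; apply: le_trans (br s).
have : 1 < normc (b s)%:C by [].
by rewrite normc_real ger0_norm// => /ltW.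
Qed.

End algebra.
End bounded_continuous.

(** * Spectra *)

Section homeomorphisms.

Lemma homeomorphic_sym (X Y : topologicalType) :
  homeomorphic X Y -> homeomorphic Y X.
Proof. by move=> [f [g [fK gK cf cg]]]; exists g, f; split. Qed.

Lemma homeomorphic_trans (Y X Z : topologicalType) :
  homeomorphic X Y -> homeomorphic Y Z -> homeomorphic X Z.
Proof.
move=> [f [g [fK gK cf cg]]] [f' [g' [fK' gK' cf' cg']]].
exists (f' \o f), (g \o g'); split; [exact: can_comp|exact: can_comp| |].
- by move=> x; apply: continuous_comp; [exact: cf|exact: cf'].
- by move=> x; apply: continuous_comp; [exact: cg'|exact: cg].
Qed.

Lemma continuous_set_type (T U : topologicalType) (A : set U) (f : T -> set_type A) :
  continuous (fun t => val (f t)) -> continuous f.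
Proof.
move=> cf; apply/continuousP => _ [V oV <-].
by rewrite -comp_preimage; apply: open_comp => // *; exact: cf.
Qed.

Lemma continuous_ptws (T : topologicalType) (I : choiceType) (U : topologicalType)
    (F : T -> {ptws I -> U}) :
  (forall i, continuous (fun t => F t i)) -> continuous F.
Proof.
move=> cF x; apply/cvg_sup => i A [_ [[V oV <-] Vx] VA].
by apply: filterS VA _; apply: (cF i x); exact: open_nbhs_nbhs.
Qed.

(** Complete regularity gives [f] with [f z = 0] and [f = 1] off [U] intersected with the interior
    of a compact neighbourhood [K] of [z]. Then [1 - f] vanishes off [K], which puts it in [C0]. *)
Lemma C0_bump (R : realType) (Z : topologicalType) (U : set Z) (z : Z) :
  locally_compact_hausdorff Z -> open U -> U z ->
  exists g : Z -> R[i], [/\ C0 g, g z = 1 & forall t, ~ U t -> g t = 0].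
Proof.
move=> [Zlc ZT2] oU Uz.
have [K zK [Kc Kcl]] := Zlc z I.
have [f [cf f01 fz fB]] : exists f : Z -> R, [/\ continuous f, range f `<=` `[0, 1],
    f @` [set z] `<=` [set 0] & f @` (~` (U `&` K^°)) `<=` [set 1]].
  apply/uniform_separatorP/(locally_compact_completely_regular (R := R)) => //.
    by apply: open_closedC; apply: openI => //; exact: open_interior.
  by move=> []; split=> //; apply: (@filterS _ (nbhs z) _ _ _ _ zK) => t; exact.
have f1 t : ~ (U `&` K) t -> f t = 1.
  move=> nUK; apply: fB; exists t => // -[Ut /interior_subset Kt].
  by apply: nUK; split.
have fle t : 0 <= f t <= 1.
  by have /= := f01 (f t) (imageT f t); rewrite in_itv.
exists (fun t => (1 - f t)%:C); split; last 2 first.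
- by rewrite (fz (f z)) ?subr0//; exists z.
- by move=> t nUt; rewrite f1 ?subrr// => -[].
have cg : continuous (fun t => (1 - f t)%:C : R[i]).
  move=> t; apply: continuous_comp; last exact: continuous_real_complex.
  by apply: cvgB; [exact: cvg_cst|exact: cf].
apply/C0P; split=> [|eps eps0].
  apply/CBP; split=> //; exists 1 => // t; rewrite normc_real.
  by rewrite ler_norml; have := fle t; lra.
apply: subclosed_compact Kc _; first exact: closed_normc_ge.
move=> t epsg; apply: contrapT => nKt; move: epsg.
by rewrite /mkset f1 => [|[]//]; rewrite subrr normc0 leNgt eps0.
Qed.

End homeomorphisms.

Section spectra.
Variable R : realType.

Section evaluation.
Variables (X : Type) (A : set (X -> R[i])).

Lemma continuous_spectrum (T : topologicalType) (F : T -> spectrum A) :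
  (forall f, continuous (fun t => val (F t) f)) -> continuous F.
Proof. by move=> cF; apply/continuous_set_type/continuous_ptws. Qed.

Lemma continuous_spectrum_eval (f : set_type A) :
  continuous (fun phi : spectrum A => val phi f).
Proof.
move=> phi; apply: (@continuous_comp _ _ _ (val : spectrum A -> {ptws set_type A -> R[i]})
  (fun p => p f)); first exact: initial_continuous.
exact: (@proj_continuous _ (fun=> R[i]) f).
Qed.

Lemma spectrumP (phi : spectrum A) : character (val phi).
Proof. exact: set_mem (valP phi). Qed.

Definition to_spectrum (phi : set_type A -> R[i]) (phi_char : character phi) :
  spectrum A :=
  exist (fun p => p \in [set psi : {ptws set_type A -> R[i]} | character psi])
    phi (mem_set phi_char).

Lemma spectrum_inj (phi psi : spectrum A) :
  (forall f, val phi f = val psi f) -> phi = psi.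
Proof. by move=> eq; apply/val_inj/funext. Qed.

End evaluation.


(** Composition with the isomorphism and with its inverse transports characters both ways.
    Evaluating a transported character at [g] is evaluating the original one at the preimage of [g],
    whence continuity for pointwise convergence. *)
Lemma spectrum_isomorphic (X Y : topologicalType)
    (A : set (X -> R[i])) (B : set (Y -> R[i])) :
  CB_ideal A -> isometrically_isomorphic A B ->
  homeomorphic (spectrum A) (spectrum B).
Proof.
move=> A_ideal [T [[TAB Tinj Tsurj] TD TZ TM _]].
have Aval (f : set_type A) : A (val f) by exact: set_mem (valP f).
pose t (f : set_type A) : set_type B :=
  exist _ (T (val f)) (mem_set (TAB _ (Aval f))).
have /choice[s sP] : forall g : set_type B, exists f : set_type A, T (val f) = val g.
  move=> g; have [f Af fg] := Tsurj _ (set_mem (valP g)).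
  by exists (exist _ f (mem_set Af)).
have Teq f g : A f -> A g -> T f = T g -> f = g.
  by move=> Af Ag; apply: Tinj; exact/mem_set.
have tK : cancel t s by move=> f; apply/val_inj/Teq => //; rewrite sP.
have sK : cancel s t by move=> g; apply/val_inj; rewrite /= sP.
have push (phi : spectrum A) : character (fun g => val phi (s g)).
  have [phiD phiZ phiM [f phif]] := spectrumP phi.
  split=> [f' g h hE|a f' h hE|f' g h hE|].
  - apply: phiD; apply: Teq => //; first exact: (ideal_add A_ideal).
    by rewrite TD// !sP.
  - apply: phiZ; apply: Teq => //; first exact: (ideal_scale A_ideal).
    by rewrite TZ// !sP.
  - apply: phiM; apply: Teq => //; last by rewrite TM// !sP.
    exact/(ideal_mul A_ideal)/Aval/(ideal_CB A_ideal).
  - by exists (t f); rewrite tK.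
have pull (psi : spectrum B) : character (fun f => val psi (t f)).
  have [psiD psiZ psiM [g psig]] := spectrumP psi.
  split=> [f' g' h hE|a f' h hE|f' g' h hE|].
  - by apply: psiD; rewrite /= hE TD.
  - by apply: psiZ; rewrite /= hE TZ.
  - by apply: psiM; rewrite /= hE TM.
  - by exists (s g); rewrite sK.
exists (fun phi => to_spectrum (push phi)), (fun psi => to_spectrum (pull psi)).
split=> [phi|psi||].
- by apply: spectrum_inj => f /=; rewrite tK.
- by apply: spectrum_inj => g /=; rewrite sK.
- by apply: continuous_spectrum => g; exact: continuous_spectrum_eval.
- by apply: continuous_spectrum => f; exact: continuous_spectrum_eval.
Qed.

End spectra.

(** * Characters of an ideal of bounded continuous functions *)

Section characters.
Variables (R : realType) (Z : topologicalType) (A : set (Z -> R[i])).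
Hypothesis A_ideal : CB_ideal A.
Variable phi : set_type A -> R[i].
Hypothesis phi_char : character phi.

Let mem f (Af : A f) : set_type A := exist _ f (mem_set Af).

(* [phi] as a function on all functions, with junk value [0] outside [A]. *)
Definition character_ext (f : Z -> R[i]) : R[i] :=
  if pselect (A f) is left Af then phi (mem Af) else 0.

Lemma character_extE f : character_ext (val f) = phi f.
Proof.
rewrite /character_ext; case: pselect => [Af|]; first by congr phi; exact: val_inj.
by case; exact: set_mem (valP f).
Qed.

Lemma character_ext_mem f (Af : A f) : character_ext f = phi (mem Af).
Proof. by rewrite -character_extE. Qed.

Lemma character_extD f g : A f -> A g ->
  character_ext (f + g) = character_ext f + character_ext g.
Proof.
move=> Af Ag; rewrite (character_ext_mem Af) (character_ext_mem Ag).
rewrite (character_ext_mem (ideal_add A_ideal Af Ag)).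
by have [phiD _ _ _] := phi_char; exact: phiD.
Qed.

Lemma character_extZ a f : A f -> character_ext (a *: f) = a * character_ext f.
Proof.
move=> Af; rewrite (character_ext_mem Af).
rewrite (character_ext_mem (ideal_scale A_ideal a Af)).
by have [_ phiZ _ _] := phi_char; exact: phiZ.
Qed.

Lemma character_extM f g : A f -> A g ->
  character_ext (f * g) = character_ext f * character_ext g.
Proof.
move=> Af Ag; rewrite (character_ext_mem Af) (character_ext_mem Ag).
rewrite (character_ext_mem (ideal_mul A_ideal (ideal_CB A_ideal Af) Ag)).
by have [_ _ phiM _] := phi_char; exact: phiM.
Qed.

Lemma character_unit : exists2 u, A u & character_ext u = 1.
Proof.
have [_ _ _ [f phif]] := phi_char; have Af := set_mem (valP f).
exists ((phi f)^-1 *: val f); first exact: ideal_scale.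
by rewrite character_extZ// character_extE mulVf.
Qed.

Lemma character_kernel_ideal : CB_ideal [set f | A f /\ character_ext f = 0].
Proof.
have [u Au phiu] := character_unit.
split=> [f [Af _]||f g [Af f0] [Ag g0]|f g CBf [Ag g0]].
- exact: (ideal_CB A_ideal).
- have [_ A0 _ _] := A_ideal; split=> //.
  have -> : (fun=> 0) = (0 : R[i]) *: (fun=> 0 : R[i]) :> (Z -> R[i]).
    by apply/funext => t; rewrite fctE scale0r.
  by rewrite character_extZ// mul0r.
- by split; [exact: (ideal_add A_ideal)|rewrite character_extD// f0 g0 addr0].
- have Afg : A (f * g) by exact: (ideal_mul A_ideal).
  have Afu : A (f * u) by exact: (ideal_mul A_ideal).
  (* As [f] need not lie in [A], the unit value of [u] is borrowed: [phi (f g) = phi (u f g) = phi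
     (f u) phi g = 0]. *)
  split=> //; rewrite -[LHS]mul1r -phiu -character_extM//.
  by rewrite mulrCA mulrA character_extM// g0 mulr0.
Qed.

(* Otherwise [g = v / (1 - v)] would satisfy [g = v + v g], so that
   [phi g = 1 + phi g]. *)
Lemma character_not_small v : A v -> character_ext v = 1 ->
  ~ (forall t, normc (v t) <= 2^-1).
Proof.
move=> Av phiv v2.
have CBv := ideal_CB A_ideal Av.
have v1 t : 2^-1 <= normc (1 - v t).
  by have := le_normcD (1 - v t) (v t); rewrite subrK normc1; have := v2 t; lra.
have v0 t : 1 - v t != 0 by rewrite -normc_gt0 (lt_le_trans _ (v1 t)).
have cv : continuous (fun t => 1 - v t).
  by apply: continuous_subc (CB_continuous CBv); exact: cst_continuous.
pose g := (fun t => (1 - v t)^-1) * v.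
have half0 : 0 < 2^-1 :> R by rewrite invr_gt0.
have Ag : A g by exact: (ideal_mul A_ideal (CB_inv cv half0 v1) Av).
have gE : g = v + v * g.
  by apply/funext => t; rewrite /g !fctE; field; exact: v0.
have Avg : A (v * g) by exact: (ideal_mul A_ideal).
have := congr1 character_ext gE; rewrite character_extD// character_extM// phiv.
by rewrite mul1r => /eqP; rewrite -subr_eq subrr eq_sym oner_eq0.
Qed.

End characters.

(** * The spectrum of [C0 Z] *)

Section gelfand.
Variables (R : realType) (Z : topologicalType).

Lemma C0_character_eval (phi : set_type (@C0 R Z) -> R[i]) :
  character phi -> exists z, forall f, phi f = val f z.
Proof.
move=> phi_char; have C0I := @C0_ideal R Z.
apply: contrapT => noz.
have {noz} ne z : exists f : set_type (@C0 R Z), phi f != val f z.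
  apply: contrapT => nof; apply: noz; exists z => f.
  by apply: contrapT => /eqP fz; apply: nof; exists f.
have [u C0u phiu] := character_unit C0I phi_char.
have [CBu Ku] := (C0P u).1 C0u.
have half0 : 0 < 2^-1 :> R by rewrite invr_gt0.
have [|r [[C0r phir] r0 rK]] :=
  dominating_square_sum (character_kernel_ideal C0I phi_char) (Ku _ half0).
  move=> z Kz; have [f fz] := ne z; have C0f := set_mem (valP f).
  have uz : u z != 0 by rewrite -normc_gt0 (lt_le_trans half0).
  have C0fu : C0 (val f * u) by apply: (ideal_mul C0I) => //; case: C0f.
  (* This is [(f - phi f) u]: multiplying by [u] brings the constant [phi f] into [C0]. It is killed
     by [phi] since [phi u = 1], and is nonzero at [z] since [u z] and [f z - phi f] are. *)
  exists (val f * u + (- phi f) *: u); last first.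
    by rewrite !fctE scaleNr -mulrBl mulf_neq0// subr_eq0 eq_sym.
  split; first by apply: (ideal_add C0I) => //; exact: (ideal_scale C0I).
  rewrite (character_extD C0I)//; last exact: (ideal_scale C0I).
  rewrite (character_extM C0I)// (character_extZ C0I)// phiu character_extE.
  by rewrite !mulr1 subrr.
have [M M0 uM] := ((CBP u).1 CBu).2.
pose c := M / 2^-1; have c0 : 0 <= c by rewrite divr_ge0// ltW.
pose v := (fun t => ((1 + c * r t)%:C)^-1) * u.
have C0v : C0 v.
  apply: (ideal_mul C0I) => //; apply: CB_damping => //.
  exact/CB_continuous/(ideal_CB C0I).
have [//||] := @character_not_small _ _ _ C0I _ phi_char v; last first.
  move=> t; rewrite /v fctE mulrC.
  exact: (damping_small (f := u) half0 M0 uM r0 rK).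
have C0vr : C0 (v * (fun t => (r t)%:C)) by apply: (ideal_mul C0I) => //; case: C0v.
(* Since [phi r = 0], applying [phi] to this splitting gives [phi v = phi u = 1]. *)
have uE : u = v + c%:C *: (v * (fun t => (r t)%:C)).
  by apply/funext => t; exact: damping_split.
have phivr : character_ext phi (v * (fun t => (r t)%:C)) = 0.
  by rewrite (character_extM C0I phi_char C0v C0r) phir mulr0.
have := congr1 (character_ext phi) uE.
rewrite (character_extD C0I phi_char C0v (ideal_scale C0I _ C0vr)).
by rewrite (character_extZ C0I phi_char _ C0vr) phivr phiu mulr0 addr0.
Qed.

Hypothesis Zlch : locally_compact_hausdorff Z.

Lemma eval_character z : character (fun f : set_type (@C0 R Z) => val f z).
Proof.
split=> [f g h ->|a f h ->|f g h ->|] //.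
have [g [C0g gz _]] := C0_bump R Zlch openT (I : [set: Z] z).
by exists (exist _ g (mem_set C0g)); rewrite /= gz oner_eq0.
Qed.

Lemma spectrum_C0 : homeomorphic Z (spectrum (@C0 R Z)).
Proof.
pose ev z := to_spectrum (eval_character z).
have /choice[G GP] : forall phi : spectrum (@C0 R Z), exists z,
    forall f, val phi f = val f z.
  by move=> phi; exact/C0_character_eval/spectrumP.
have evK : cancel ev G.
  move=> z; apply: contrapT => Gz; have [_ ZT2] := Zlch.
  (* A bump equal to [1] at [z] and [0] at [G (ev z)] would take both values under the same
     character. *)
  have oG : open (~` [set G (ev z)]).
    exact/closed_openC/accessible_closed_set1/hausdorff_accessible.
  have [|g [C0g gz g0]] := C0_bump R Zlch oG (z := z).
    by move=> zG; apply: Gz.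
  have /= := GP (ev z) (exist _ g (mem_set C0g)); rewrite gz g0.
    by move/eqP; rewrite oner_eq0.
  by apply.
exists ev, G; split=> //.
- by move=> phi; apply: spectrum_inj => f; rewrite [RHS]GP.
- apply: continuous_spectrum => f.
  by have [/CB_continuous] := set_mem (valP f).
(* For a bump [g] at [G phi] vanishing off [U], the characters not killing [g] form an open
   neighbourhood of [phi] that [G] maps into [U]. *)
apply/continuousP => U oU; rewrite openE => phi UG.
have [g [C0g gz g0]] := C0_bump R Zlch oU UG.
pose gA : set_type (@C0 R Z) := exist _ g (mem_set C0g).
have := open_normc_gt 0 (@continuous_spectrum_eval _ _ _ gA).
rewrite openE => /(_ phi) nphi.
apply: filterS (nphi _) => [psi /= psig|]; last first.
  by rewrite /mkset normc_gt0 GP/= gz oner_neq0.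
apply: contrapT => /g0 Gpsi; move: psig.
by rewrite normc_gt0 GP/= Gpsi eqxx.
Qed.

End gelfand.

(** * Extension to the Stone-Cech compactification *)

Lemma compact_preimage_val (T : topologicalType) (A K : set T) :
  K `<=` A -> compact K -> compact ((val : set_type A -> T) @^-1` K).
Proof.
move=> KA cK F PF FK.
have [|p [Kp clp]] := cK ((val : set_type A -> T) @ F) (fmap_proper_filter _ PF).
  exact: FK.
exists (exist _ p (mem_set (KA _ Kp))); split=> // S U FS [V [[W oW <-] Wp] WU].
have [||_ [[s Ss <-] Ws]] := clp (val @` S) W.
- by apply: (@filterS _ F _ S) FS => s Ss; exists s.
- exact: open_nbhs_nbhs.
by exists s; split=> //; exact: WU.
Qed.

Lemma continuous_val (T : topologicalType) (A : set T) :
  continuous (val : set_type A -> T).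
Proof. exact: initial_continuous. Qed.

Section stone_cech_extension.
Variables (R : realType) (X bX : topologicalType) (e : X -> bX).
Hypothesis he : stone_cech e.

Lemma stone_cech_continuous : continuous e.
Proof.
by have [_ [_ eo] _ _] := he; apply/continuousP => V oV; apply/eo; exists V.
Qed.

(** The open set where [|F| > M] would otherwise meet the dense image of [X]. Both the uniqueness of
    extensions and the isometry rest on this. *)
Lemma stone_cech_normc_le (F : bX -> R[i]) (M : R) : continuous F ->
  (forall x, normc (F (e x)) <= M) -> forall p, normc (F p) <= M.
Proof.
move=> cF FM p; rewrite leNgt; apply/negP => Mp.
have [_ _ ed _] := he.
have [||q [/= MFq [x _ xE]]] := ed [set q | M < normc (F q)].
- by exists p.
- exact: open_normc_gt.
by move: MFq; rewrite -xE ltNge FM.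
Qed.

Lemma stone_cech_ext_unique (F G : bX -> R[i]) : continuous F -> continuous G ->
  (forall x, F (e x) = G (e x)) -> F = G.
Proof.
move=> cF cG FG; apply/funext => p.
have FGp : normc (F p - G p) <= 0.
  apply: (stone_cech_normc_le (continuous_subc cF cG)) => x.
  by rewrite FG subrr normc0.
by apply/eqP; rewrite -subr_eq0 -normc_eq0 eq_le FGp normc_ge0.
Qed.

Lemma stone_cech_real_ext (f : X -> R) (M : R) : continuous f ->
  (forall x, `|f x| <= M) ->
  exists2 F : bX -> R, continuous F & forall x, F (e x) = f x.
Proof.
move=> cf fM; have [_ _ _ ext] := he.
have fI x : f x \in `[- M, M]%classic by rewrite inE/= in_itv/= -ler_norml.
have [||F cF Fe] := ext (set_type `[- M, M]%classic)
  (fun x => exist (fun y => y \in `[- M, M]%classic) (f x) (fI x)).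
- split; first exact/compact_set_type/segment_compact.
  exact/hausdorff_set_type/Rhausdorff.
- exact: continuous_set_type.
exists (fun p => val (F p)) => [p|x]; last by rewrite Fe.
by apply: continuous_comp; [exact: cF|exact: continuous_val].
Qed.

(** The universal property needs compact targets, so real and imaginary parts are extended
    separately, each with values in [[- M, M]]. The bound on the modulus then passes to [bX] by
    density. *)
Lemma stone_cech_ext (f : X -> R[i]) : CB f ->
  exists2 F : bX -> R[i], CB F & forall x, F (e x) = f x.
Proof.
move=> /CBP[cf [M M0 fM]].
have [||F cF Fe] := @stone_cech_real_ext (fun x => complex.Re (f x)) M.
- by move=> x; apply: continuous_comp; [exact: cf|exact: continuous_Re].
- by move=> x; apply: le_trans (fM x); exact: normc_ge_Re.
have [||G cG Ge] := @stone_cech_real_ext (fun x => complex.Im (f x)) M.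
- by move=> x; apply: continuous_comp; [exact: cf|exact: continuous_Im].
- by move=> x; apply: le_trans (fM x); exact: normc_ge_Im.
pose E p := (F p)%:C + 'i * (G p)%:C.
have Ee x : E (e x) = f x by rewrite /E Fe Ge -complexE.
have cE : continuous E.
  have cC (g : bX -> R) : continuous g -> continuous (fun p => (g p)%:C).
    by move=> cg p; apply: continuous_comp; [exact: cg|exact: continuous_real_complex].
  have ci : continuous (fun _ : bX => 'i : R[i]) by exact: cst_continuous.
  exact: continuous_addc (cC _ cF) (continuous_mulc ci (cC _ cG)).
exists E => //; apply/CBP; split=> //; exists M => // p.
by apply: stone_cech_normc_le => // x; rewrite Ee.
Qed.

Lemma CB_comp_stone_cech (F : bX -> R[i]) : CB F -> CB (fun x => F (e x)).
Proof.
move=> /CBP[cF [M M0 FM]]; apply/CBP; split; last by exists M.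
by move=> x; apply: continuous_comp; [exact: stone_cech_continuous|exact: cF].
Qed.

End stone_cech_extension.

(** * The support of the ideal as an open subspace of the compactification *)

Section ideal_support.
Variables (R : realType) (X bX : topologicalType) (e : X -> bX).
Variable H : set (X -> R[i]).
Hypotheses (he : stone_cech e) (H_ideal : CB_ideal H).

Let Y : topologicalType := set_type (ideal_support e H).

(** Restriction along [e] identifies [CB bX] with [CB X]; this is [H] transported to [bX], where
    compactness is available. *)
Definition ideal_ext : set (bX -> R[i]) :=
  [set F | CB F /\ H (fun x => F (e x))].

Lemma ideal_ext_ideal : CB_ideal ideal_ext.
Proof.
split=> [F []|| F G [CBF HF] [CBG HG]|F G CBF [CBG HG]] //.
- by split; [exact: CB_cst|have [] := H_ideal].
- by split; [exact: CB_add|exact: (ideal_add H_ideal HF HG)].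
- split; first exact: CB_mul.
  exact: (ideal_mul H_ideal (CB_comp_stone_cech he CBF) HG).
Qed.

(** In a closure, [1 < |h|] only survives as [1 <= |F|], which still gives [F p != 0]. Conversely,
    scaling to [G p = 2] makes [|G| > 1] on an open set around [p], and every neighbourhood of [p]
    meets the image of [X] inside that set by density. *)
Lemma ideal_supportP p :
  ideal_support e H p <-> exists2 F, ideal_ext F & F p != 0.
Proof.
split=> [[h Hh hp]|[F [CBF HF] Fp]].
  have [F CBF Fe] := stone_cech_ext he (ideal_CB H_ideal Hh).
  exists F; first by split=> //; congr (H _): Hh; apply/funext => x; rewrite Fe.
  have : [set q | 1 <= normc (F q)] p.
    have /closure_id -> := closed_normc_ge (r := 1) (CB_continuous CBF).
    apply: closureS hp => _ [x hx <-]; rewrite /mkset Fe ltW//.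
    by move: hx; rewrite /mkset normr_normc ltcR.
  by rewrite -normc_gt0; exact: lt_le_trans.
pose G := (2 / F p) *: F.
have [CBG HG] : ideal_ext G by exact: (ideal_scale ideal_ext_ideal).
exists (fun x => G (e x)) => // V Vp.
have oG := open_normc_gt 1 (CB_continuous CBG).
have Gp : [set q | 1 < normc (G q)] p.
  rewrite /mkset /G fctE -[_ *: _]/(_ * _) divfK//.
  by rewrite -(rmorph_nat (real_complex R)) normc_real ger0_norm// ltr1n.
have [_ _ ed _] := he.
have [||q [[Vq Gq] [x _ xE]]] := ed (V^° `&` [set q | 1 < normc (G q)]).
- by exists p.
- by apply: openI => //; exact: open_interior.
exists q; split; last exact: interior_subset.
by exists x => //; rewrite /mkset normr_normc ltcR xE.
Qed.

Lemma open_ideal_support : open (ideal_support e H).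
Proof.
rewrite openE => p /ideal_supportP[F FH Fp].
have oF := open_normc_gt 0 (CB_continuous (ideal_CB ideal_ext_ideal FH)).
apply: filterS (open_nbhs_nbhs (conj oF _)) => [q|].
  by rewrite /mkset normc_gt0 => Fq; apply/ideal_supportP; exists F.
by rewrite /mkset normc_gt0.
Qed.

(** In [bX] this superlevel set is closed, hence compact, and it already lies in the support. So
    extensions of members of [H] restrict to elements of [C0 Y]. *)
Lemma compact_normc_ge F (eps : R) : ideal_ext F -> 0 < eps ->
  compact [set y : Y | eps <= normc (F (val y))].
Proof.
move=> FH eps0; have [[bXc bXT2] _ _ _] := he.
apply: (@compact_preimage_val _ _ [set p | eps <= normc (F p)]).
  move=> p Fp; apply/ideal_supportP; exists F => //.
  by rewrite -normc_gt0 (lt_le_trans eps0).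
apply: subclosed_compact bXc _ => //.
exact/closed_normc_ge/CB_continuous/(ideal_CB ideal_ext_ideal).
Qed.

Lemma continuous_comp_val F : continuous F -> continuous (fun y : Y => F (val y) : R[i]).
Proof. by move=> cF y; apply: continuous_comp; [exact: continuous_val|exact: cF]. Qed.

Lemma ideal_support_locally_compact : locally_compact_hausdorff Y.
Proof.
have [[_ bXT2] _ _ _] := he; split; last exact: hausdorff_set_type.
move=> y _; have /ideal_supportP[F FH Fy] := set_mem (valP y).
have cF := CB_continuous (ideal_CB ideal_ext_ideal FH).
have Fy0 : 0 < normc (F (val y)) by rewrite normc_gt0.
exists [set z : Y | normc (F (val y)) / 2 <= normc (F (val z))]; last first.
  split; first by apply: compact_normc_ge => //; rewrite divr_gt0.
  exact/closed_normc_ge/continuous_comp_val.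
have oF := open_normc_gt (normc (F (val y)) / 2) (continuous_comp_val cF).
apply: (@filterS _ (nbhs y) _ _ _ _ (open_nbhs_nbhs (conj oF _))).
  by move=> z /ltW.
by rewrite /mkset; lra.
Qed.

Section extension_by_zero.
Variable g : Y -> R[i].
Hypothesis C0g : C0 g.

Let G p := if pselect (ideal_support e H p) is left Hp
  then g (exist _ p (mem_set Hp)) else 0.

(** Continuity at points of the support comes from [g], as the support is open. At the other points,
    [|g| >= eps] holds on a compact, hence closed, subset of [bX], whose complement is a
    neighbourhood where [|G| < eps]. *)
Lemma extension_by_zero : exists2 G : bX -> R[i],
  CB G & (forall y : Y, G (val y) = g y) /\
    forall p, G p != 0 -> ideal_support e H p.
Proof.
have GE (y : Y) : G (val y) = g y.
  rewrite /G; case: pselect => [Hp|]; first by congr g; exact: val_inj.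
  by case; exact: set_mem (valP y).
have GN p : ~ ideal_support e H p -> G p = 0 by rewrite /G; case: pselect.
have [/CBP[cg [M M0 gM]] Kg] := (C0P g).1 C0g.
exists G; last first.
  by split=> // p Gp; apply: contrapT => /GN G0; rewrite G0 eqxx in Gp.
apply/CBP; split; last first.
  exists M => // p; have [Hp|/GN ->] := pselect (ideal_support e H p).
    by rewrite -[p]/(val (exist _ p (mem_set Hp) : Y)) GE.
  by rewrite normc0.
move=> p; apply/(cvg_normcP (nbhs_filter p)) => eps eps0.
have [Hp|nHp] := pselect (ideal_support e H p).
  pose y : Y := exist _ p (mem_set Hp).
  have /(cvg_normcP (nbhs_filter y))/(_ eps eps0) := cg y.
  move=> [_ [[W oW <-] Wy] WS].
  have oWH := openI oW open_ideal_support.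
  apply: filterS (open_nbhs_nbhs (conj oWH (conj Wy Hp))) => q [Wq Hq].
  rewrite -[p]/(val y) -[q]/(val (exist _ q (mem_set Hq) : Y)) !GE.
  exact: WS.
have [[_ bXT2] _ _ _] := he.
have /(compact_closed bXT2) clK :
    compact ((val : Y -> bX) @` [set y | eps <= normc (g y)]).
  apply: continuous_compact (Kg _ eps0).
  by apply: continuous_subspaceT; exact: continuous_val.
apply: filterS (open_nbhs_nbhs (conj (closed_openC clK) _)) => [q nKq|]; last first.
  by move=> [y _ yp]; apply: nHp; rewrite -yp; exact: set_mem (valP y).
rewrite (GN _ nHp) sub0r normcN; have [Hq|/GN ->] := pselect (ideal_support e H q).
  rewrite ltNge; apply/negP; rewrite -[q]/(val (exist _ q (mem_set Hq) : Y)) GE => Kq.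
  by apply: nKq; exists (exist _ q (mem_set Hq)).
by rewrite normc0.
Qed.

End extension_by_zero.
End ideal_support.

(** * The isometry of a closed non-vanishing ideal onto [C0 Y] *)

Lemma sup_norm_ge0 (R : realType) (T : topologicalType) (f : T -> R[i]) :
  CB f -> 0 <= sup_norm f.
Proof.
move=> CBf; have [[t _]|T0] := pselect ([set: T] !=set0).
  exact: le_trans (normc_ge0 (f t)) (normc_le_sup_norm t CBf).
rewrite /sup_norm [X in sup X](_ : _ = set0) ?sup0//.
by apply/seteqP; split=> // r [t _ _]; case: T0; exists t.
Qed.

Section closed_ideal.
Variables (R : realType) (X bX : topologicalType) (e : X -> bX).
Variable H : set (X -> R[i]).
Hypotheses (he : stone_cech e) (H_ideal : CB_ideal H).
Hypotheses (H_closed : CB_closed H) (H_nv : non_vanishing H).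

Let Y : topologicalType := set_type (ideal_support e H).

(** Closedness of [H] enters here, through the damping argument; surjectivity onto [C0 Y] will
    follow. *)
Lemma closed_ideal_mem (F : bX -> R[i]) : CB F ->
  (forall p, F p != 0 -> ideal_support e H p) -> H (fun x => F (e x)).
Proof.
move=> CBF FY; have CBFe := CB_comp_stone_cech he CBF.
apply: H_closed => // eps eps0.
(* Damping gives a weak inequality while closedness asks for a strict one, hence the half. *)
have eps20 : 0 < eps / 2 by rewrite divr_gt0.
have [[bXc bXT2] _ _ _] := he.
have Kc : compact [set p | eps / 2 <= normc (F p)].
  apply: subclosed_compact bXc _ => //.
  exact/closed_normc_ge/CB_continuous.
have [|r [[CBr Hr] r0 rK]] :=
  dominating_square_sum (ideal_ext_ideal he H_ideal) Kc.
  move=> p Kp; apply/(ideal_supportP he H_ideal)/FY.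
  by rewrite -normc_gt0 (lt_le_trans eps20).
have /CBP[_ [M M0 FM]] := CBF.
pose c := M / (eps / 2); have c0 : 0 <= c by rewrite divr_ge0// ltW.
have CBd := CB_damping (CB_continuous CBr) r0 c0.
have small := damping_small eps20 M0 FM r0 rK.
have CBh := CB_mul (CB_cst _ c%:C) (CB_mul CBd CBF).
(* The approximant [c r F / (1 + c r)] is in [H] because of its factor [r], and it differs from [F]
   by [F / (1 + c r)]. *)
exists ((fun x => c%:C * (((1 + c * r (e x))%:C)^-1 * F (e x))) * (fun x => (r (e x))%:C)).
  by apply: (ideal_mul H_ideal) Hr; exact: (CB_comp_stone_cech he CBh).
apply: (@le_lt_trans _ _ (eps / 2)); last by rewrite ltr_pdivrMr// mulr_natr mulr2n ltrDl.
apply: sup_norm_le => [|x]; first exact: ltW.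
apply: le_trans (small (e x)); rewrite le_eqVlt; apply/orP; left.
apply/eqP; congr normc; rewrite -[_ x]/(F (e x) - _ * _ * _) -mulrA.
by rewrite {1}(damping_split (F (e x)) c0 (r0 (e x))) addrK mulrC.
Qed.

Lemma embed_in_support x : e x \in ideal_support e H.
Proof.
apply/mem_set/(ideal_supportP he H_ideal).
have [h Hh hx] := H_nv x.
have [F CBF Fe] := stone_cech_ext he (ideal_CB H_ideal Hh).
exists F; last by rewrite Fe.
by split=> //; congr (H _): Hh; apply/funext => z; rewrite Fe.
Qed.

Definition support_embedding x : Y := exist _ (e x) (embed_in_support x).

Lemma support_embedding_embedding : topological_embedding support_embedding.
Proof.
have [_ [einj eo] _ _] := he; split=> [x y /(congr1 val)|U]; first exact: einj.
rewrite eo; split=> [[V oV <-]|[_ [V oV <-] <-]]; last by exists V.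
by exists (val @^-1` V) => //; exists V.
Qed.

(** The support is open, so a nonempty open subset of [Y] is also open in [bX] and meets the image
    of [X]. *)
Lemma support_embedding_dense : dense (range support_embedding).
Proof.
have [_ _ ed _] := he => O [y Wy] [W oW WE]; rewrite -WE in Wy *.
have [||p [[Wp _] [x _ xE]]] := ed (W `&` ideal_support e H).
- by exists (val y); split=> //; exact: set_mem (valP y).
- by apply: openI => //; exact: open_ideal_support.
rewrite -xE in Wp.
by exists (support_embedding x); split; [exact: Wp|exists x].
Qed.

Lemma isometrically_isomorphic_C0 : isometrically_isomorphic H (@C0 R Y).
Proof.
have /choice[ext extP] : forall f : X -> R[i], exists F : bX -> R[i],
    CB f -> CB F /\ forall x, F (e x) = f x.
  move=> f; have [CBf|] := pselect (CB f); last by exists (fun=> 0).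
  by have [F CBF Fe] := stone_cech_ext he CBf; exists F.
have HCB f : H f -> CB f := @ideal_CB _ _ _ H_ideal f.
have extCB f : H f -> CB (ext f) by move=> /HCB/extP[].
have extE f x : H f -> ext f (e x) = f x by move=> /HCB/extP[].
have extH f : H f -> ideal_ext e H (ext f).
  move=> Hf; split; first exact: extCB.
  by congr (H _): (Hf); apply/funext => x; rewrite extE.
(* Although [ext] is merely chosen, uniqueness of extensions makes [T] additive, homogeneous and
   multiplicative. *)
have ext_unique f F : H f -> CB F -> (forall x, F (e x) = f x) -> ext f = F.
  move=> Hf [cF _] Fe; apply: (stone_cech_ext_unique he _ cF) => [|x].
    exact/CB_continuous/extCB.
  by rewrite extE.
pose T f (y : Y) := ext f (val y).
have TCB f : H f -> CB (T f).
  move=> Hf; have /CBP[cF [M M0 FM]] := extCB f Hf.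
  apply/CBP; split; first exact: continuous_comp_val.
  by exists M => // y; exact: FM.
exists T; split.
- split=> [f Hf|f g /set_mem Hf /set_mem Hg Tfg|g C0g].
  + apply/C0P; split; first exact: TCB.
    by move=> eps; apply: (compact_normc_ge he H_ideal); exact: extH.
  (* Every point of [X] lies in [Y], so [T f] determines [f]. *)
  + apply/funext => x; rewrite -(extE f)// -(extE g)//.
    exact: (congr1 (fun F => F (support_embedding x)) Tfg).
  + have [G CBG [GE GY]] := extension_by_zero he H_ideal C0g.
    have HG := closed_ideal_mem CBG GY.
    exists (fun x => G (e x)) => //; apply/funext => y.
    by rewrite /T (ext_unique _ G).
- move=> f g Hf Hg; have CBfg := CB_add (extCB _ Hf) (extCB _ Hg).
  rewrite /T (ext_unique _ _ _ CBfg)//; first exact: (ideal_add H_ideal).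
  by move=> x; rewrite !fctE !extE.
- move=> a f Hf; have CBaf := CB_mul (CB_cst _ a) (extCB _ Hf).
  rewrite /T (ext_unique _ _ _ CBaf)//; first exact: (ideal_scale H_ideal).
  by move=> x; rewrite !fctE !extE.
- move=> f g Hf Hg; have CBfg := CB_mul (extCB _ Hf) (extCB _ Hg).
  rewrite /T (ext_unique _ _ _ CBfg)//; first exact: (ideal_mul H_ideal (HCB _ Hf)).
  by move=> x; rewrite !fctE !extE.
(* Extending does not increase the norm, by density of [X] in [bX]; restricting to [Y] does not lose
   any of it, as [Y] contains [X]. *)
move=> f Hf; have CBf := HCB f Hf; apply/eqP; rewrite eq_le; apply/andP; split.
  apply: sup_norm_le => [|y]; first exact: sup_norm_ge0.
  apply: (stone_cech_normc_le he); first exact/CB_continuous/extCB.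
  by move=> x; rewrite extE//; exact: normc_le_sup_norm.
apply: sup_norm_le => [|x]; first exact/sup_norm_ge0/TCB.
by rewrite -(extE f)//; exact: (normc_le_sup_norm (support_embedding x) (TCB f Hf)).
Qed.

End closed_ideal.

Theorem theorem3p2p5 (R : realType) (X bX : topologicalType) (e : X -> bX)
    (H : set (X -> R[i]))
    (hX : completely_regular_hausdorff X) (he : stone_cech e)
    (hH : CB_ideal H) (H_closed : CB_closed H) (H_nv : non_vanishing H) :
  let Y : topologicalType := set_type (ideal_support e H) in
  [/\ locally_compact_hausdorff Y,
      isometrically_isomorphic H (@C0 R Y),
      forall Z : topologicalType, locally_compact_hausdorff Z ->
        isometrically_isomorphic H (@C0 R Z) -> homeomorphic Z Y,
      homeomorphic (spectrum H) Y &
      exists j : X -> Y,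
        [/\ forall x, val (j x) = e x, topological_embedding j &
            dense (range j)]].
Proof.
move=> Y.
have Ylch : locally_compact_hausdorff Y by exact: ideal_support_locally_compact.
have HY : isometrically_isomorphic H (@C0 R Y) by exact: isometrically_isomorphic_C0.
(* Any such [Z] is the spectrum of [H]: the case [Z = Y] identifies the spectrum, and two instances
   compared give uniqueness. *)
have spectrumZ Z : locally_compact_hausdorff Z ->
    isometrically_isomorphic H (@C0 R Z) -> homeomorphic (spectrum H) Z.
  move=> Zlch /(spectrum_isomorphic hH) /homeomorphic_trans; apply.
  exact/homeomorphic_sym/spectrum_C0.
split=> //; [|exact: spectrumZ|].
- move=> Z Zlch HZ; apply: homeomorphic_trans (spectrumZ Y Ylch HY).
  exact/homeomorphic_sym/spectrumZ.
exists (support_embedding he hH H_nv); split=> //.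
- exact: support_embedding_embedding.
- exact: support_embedding_dense.
Qed.
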